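(* Let $\Gamma \curvearrowright (X,\mu)$ be a measure-class preserving (mcp) Borel action of a countable group $\Gamma$ on a standard probability space $(X,\mu)$. (a) If the action is essentially boundedly chaining, then it is metrically ergodic. (b) If the action is weakly mixing, then it is chaining. (c) If the action is chaining, then it is ergodic.
   Context: $\mathbb{N}$ includes $0$. ''Positive measure'' sets are measurable sets of positive measure. The action is mcp (nonsingular) if for all Borel $A\subseteq X$ and $\gamma\in\Gamma$, $\mu(A)=0$ iff $\mu(\gamma A)=0$; it is pmp if $\mu(\gamma A)=\mu(A)$ for all such $A,\gamma$. It is ergodic if every $\Gamma$-invariant $\mu$-measurable set is null or conull. Weakly mixing: for every ergodic pmp action of $\Gamma$ on a standard probability space $(Y,\nu)$, the diagonal action $\Gamma\curvearrowright (X\times Y,\mu\times\nu)$ is ergodic. Metrically ergodic: for every action $\Gamma\curvearrowright Z$ by isometries on a separable metric space $(Z,d)$, every $\mu$-measurable $\Gamma$-equivariant map $\varphi:X\to Z$ is $\mu$-essentially constant. For $k\in\mathbb{N}$ and $A,B\subseteq X$, $A$ $k$-chains to $B$ if there are $\gamma_0,\gamma_1,\dots,\gamma_k\in\Gamma$ with $\gamma_0=1_\Gamma$, $\mu(\gamma_iA\cap\gamma_{i+1}A)>0$ for each $0\le i<k$, and $\mu(\gamma_kA\cap B)>0$. The action is chaining if for all positive measure sets $A,B\subseteq X$ there is $\ell\in\mathbb{N}$ (depending on $A,B$) such that $A$ $\ell$-chains to $B$. A measurable set $W\subseteq X$ is group generating if $\{\gamma\in\Gamma:\mu(\gamma W\cap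 W)>0\}$ generates $\Gamma$. The action is $k$-chaining on a measurable set $W\subseteq X$ if for all positive measure sets $A,B\subseteq W$, $A$ $k$-chains to $B$ (the translates in the chain are not required to be contained in, or to meet, $W$). The action is essentially $k$-chaining if it is $k$-chaining on some measurable $W\subseteq X$ that is group generating and is a $\Gamma$-complete section, i.e. $\bigcup_{\gamma\in\Gamma}\gamma W$ is $\mu$-conull. The action is essentially boundedly chaining if it is essentially $k$-chaining for some $k\in\mathbb{N}$. *)

(* Defs.v *)
From mathcomp Require Import all_boot all_order all_algebra.
From mathcomp Require Import all_classical all_reals all_analysis.
From mathcomp Require Import measurable_realfun.

Set Implicit Arguments.
Unset Strict Implicit.
Unset Printing Implicit Defensive.

Local Open Scope classical_set_scope.

Definition separable (T : topologicalType) :=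
  exists D : set T, countable D /\ dense D.

(* A Borel isomorphism with a Polish (separable, completely metrizable)
   space; the metric is not part of the data. *)
Definition standard_borel (R : realType) d (T : measurableType d) :=
  exists (P : metricType R) (f : T -> P),
    [/\ separable P,
        (forall F : set_system P, ProperFilter F -> cauchy F ->
           exists p : P, F --> p),
        bijective f &
        forall A : set T, measurable A <-> <<s @open P >> (f @` A)].

Section Actions.
Variable G : groupType.

Definition is_action (T : Type) (a : G -> T -> T) :=
  (forall x, a 1%g x = x) /\ (forall g h x, a (g * h)%g x = a g (a h x)).

(* As G is countable (hence discrete), this is Borelness of G * T -> T. *)
Definition borel_action d (T : measurableType d) (a : G -> T -> T) :=
  is_action a /\ forall g, measurable_fun setT (a g).

Definition diag_action (T U : Type) (a : G -> T -> T) (b : G -> U -> U)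
  (g : G) (p : T * U) : T * U := (a g p.1, b g p.2).

Definition generates (S : set G) :=
  forall H : {pred G}, group_closed H ->
    (forall g, S g -> g \in H) -> forall g, g \in H.

End Actions.

Section MeasuredActions.
Variables (G : groupType) (R : realType).

Section OneAction.
Variables (d : measure_display) (T : measurableType d).
Variables (a : G -> T -> T) (mu : set T -> \bar R).

Definition mcp :=
  forall (A : set T) g, measurable A -> mu A = 0%E <-> mu (a g @` A) = 0%E.

Definition pmp :=
  forall (A : set T) g, measurable A -> mu (a g @` A) = mu A.

(* The sets of the form "Borel set `|` negligible set". On these sets the
   completion of mu is given by the outer measure mu^*. *)
Definition mu_measurable (A : set T) := completed_algebra_gen mu A.

Definition positive (A : set T) := mu_measurable A /\ (0 < (mu^*)%mu A)%E.

Definition conull (A : set T) := mu.-negligible (~` A).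

Definition ergodic :=
  forall A : set T, mu_measurable A -> (forall g, a g @` A = A) ->
    mu.-negligible A \/ conull A.

Definition metrically_ergodic :=
  forall (Z : metricType R) (b : G -> Z -> Z),
    separable Z -> is_action b ->
    (forall g z w, mdist (b g z) (b g w) = mdist z w) ->
    forall phi : T -> Z,
      (forall B : set Z, <<s @open Z >> B -> mu_measurable (phi @^-1` B)) ->
      (forall g x, phi (a g x) = b g (phi x)) ->
      exists z : Z, {ae mu, forall x, phi x = z}.

Definition chains_to (k : nat) (A B : set T) :=
  exists c : nat -> G,
    [/\ c 0 = 1%g,
        (forall i, (i < k)%N ->
           (0 < (mu^*)%mu (a (c i) @` A `&` a (c i.+1) @` A))%E) &
        (0 < (mu^*)%mu (a (c k) @` A `&` B))%E].

Definition chaining :=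
  forall A B : set T, positive A -> positive B -> exists l, chains_to l A B.

Definition group_generating (W : set T) :=
  generates [set g | (0 < (mu^*)%mu (a g @` W `&` W))%E].

Definition complete_section (W : set T) :=
  conull (\bigcup_(g in [set: G]) (a g @` W)).

Definition chaining_on (k : nat) (W : set T) :=
  forall A B : set T, positive A -> positive B -> A `<=` W -> B `<=` W ->
    chains_to k A B.

Definition essentially_chaining (k : nat) :=
  exists W : set T, [/\ mu_measurable W, group_generating W,
    complete_section W & chaining_on k W].

Definition essentially_boundedly_chaining :=
  exists k : nat, essentially_chaining k.

End OneAction.

Definition weakly_mixing d (T : measurableType d) (a : G -> T -> T)
    (mu : set T -> \bar R) :=
  forall (d' : measure_display) (Y : measurableType d')
    (nu : probability Y R) (b : G -> Y -> Y),
    standard_borel R Y -> borel_action b -> pmp b nu -> ergodic b nu ->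
    ergodic (diag_action a b) (mu \x nu)%E.

End MeasuredActions.

(* Main.v *)
(* For (a), the translates of a set whose image under the equivariant map has
   small diameter have images of the same diameter, so chains of bounded length
   show that the image of W lies, up to a null set, in arbitrarily small balls.
   The essential value on W is then fixed by a generating set, hence by G.

   For (b), let H be the subgroup generated by the g with g A meeting A in
   positive measure, and C the union of the h A, for h in H. The set C is
   H-invariant, and g C is almost disjoint from C when g is not in H. If A does
   not chain to B then C almost misses B. When H = G this contradicts
   ergodicity. Otherwise take an ergodic pmp action on Y with an H-invariant D
   such that neither D nor its complement is null: the orbits of C x D and of
   C x (Y - D) are invariant and almost disjoint, and neither is null. For Y one
   takes subsets of G / H: the translates of the base point with uniform weights
   if the index is finite, fair coin tosses if it is infinite.

   The coin tossing action is ergodic because the group permutes the flips of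
   single coordinates transitively, so that an invariant set is moved equally
   far by all flips. Flips of far away coordinates hardly move it, hence it is
   flip invariant modulo null sets and independent of every cylinder, hence
   of itself. *)

Require Import Defs.
From HB Require Import structures.
From mathcomp Require Import all_boot all_order all_algebra.
From mathcomp Require Import all_classical all_reals all_analysis.
From mathcomp Require Import measurable_realfun.
From mathcomp Require Import zify lra.

Set Implicit Arguments.
Unset Strict Implicit.
Unset Printing Implicit Defensive.

Import Order.TTheory GRing.Theory Num.Theory.
Import numFieldNormedType.Exports.
Local Open Scope classical_set_scope.
Local Open Scope ring_scope.

(** * Null sets and actions *)

Section OuterNull.
Context (R : realType) d (T : measurableType d) (mu : {measure set T -> \bar R}).
Local Open Scope ereal_scope.

(** Unions of measurable covers of total mass below 1/(n+1) intersect in a measurable null set. This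
    lets positive outer measure be handled as non-negligibility. *)
Lemma mu_ext_negligible (A : set T) :
  (mu^*)%mu A = 0 <-> mu.-negligible A.
Proof.
split=> [A0|[N [mN N0 AN]]]; last first.
  apply/eqP; rewrite eq_le mu_ext_ge0 ?andbT//.
  by rewrite -N0 -measurable_mu_extE//; exact: le_mu_ext.
have cov n : exists F, measurable_cover A F /\
    \sum_(k <oo) mu (F k) < n.+1%:R^-1%:E.
  have : ereal_inf [set \sum_(k <oo) mu (F k) | F in measurable_cover A]
      < n.+1%:R^-1%:E by rewrite -/(mu_ext mu A) A0 lte_fin invr_gt0.
  by move=> /ereal_inf_lt[_ [F cF <-] Fn]; exists F.
have [F FP] := choice cov.
pose N := \bigcap_n \bigcup_k F n k.
have mF n : measurable (\bigcup_k F n k).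
  by apply: bigcupT_measurable => k; have [[/(_ k)]] := FP n.
have mN : measurable N by exact: bigcapT_measurable.
exists N; split => //; last by move=> x Ax n _; have [[_ sF] _] := FP n; exact: sF.
apply/eqP; rewrite eq_le measure_ge0 andbT.
apply/lee_addgt0Pr => _/posnumP[e]; rewrite add0e; near \oo => n.
apply: (@le_trans _ _ (mu (\bigcup_k F n k))).
  by apply: le_measure; rewrite ?inE//; exact: bigcap_inf.
have [[mFn _] /ltW sFn] := FP n.
apply: (le_trans (measure_sigma_subadditive _ mFn _ (@subset_refl _ _))) => //.
apply: (le_trans sFn); rewrite lee_fin ltW//.
by near: n; apply: near_infty_natSinv_lt.
Unshelve. all: by end_near. Qed.

Lemma negligible_countable_bigcup I (D : set I) (F : I -> set T) :
  countable D -> (forall i, D i -> mu.-negligible (F i)) ->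
  mu.-negligible (\bigcup_(i in D) F i).
Proof.
have [->|/set0P[i0 Di0]] := eqVneq D set0.
  by rewrite bigcup_set0 => *; exact: negligible_set0.
move=> /countable_injP[f finj] Fn.
(* [f'] inverts the injection [f] and takes the value [i0] off the image of [D], which turns the
   union over [D] into one over the naturals. *)
have /choice[f' f'P] n : exists i, D i /\ forall j, D j -> f j = n -> j = i.
  have [[i [Di <-]]|nf] := pselect (exists i, D i /\ f i = n).
    by exists i; split=> // j Dj; apply: finj; rewrite inE.
  by exists i0; split=> // j Dj fj; case: nf; exists j.
apply: (negligibleS (A := \bigcup_n F (f' n))); last first.
  by apply: negligible_bigcup => n; apply: Fn; case: (f'P n).
move=> x [i Di Fx]; exists (f i) => //; have [_ /(_ _ Di erefl) <-//] := f'P (f i).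
Qed.

Lemma mu_ext_gt0 (A : set T) : (0 < (mu^*)%mu A) <-> ~ mu.-negligible A.
Proof.
rewrite lt0e mu_ext_ge0// andbT -mu_ext_negligible.
by split=> [/eqP//|A0]; apply/eqP.
Qed.

Lemma negligible_outside (A : set T) : ~ mu.-negligible A ->
  forall N, mu.-negligible N -> exists2 x, A x & ~ N x.
Proof.
move=> An N Nn; apply: contrapT => h; apply: An; apply: negligibleS Nn => x Ax.
by apply: contrapT => Nx; apply: h; exists x.
Qed.

Lemma measurable_mu_measurable (A : set T) : measurable A -> mu_measurable mu A.
Proof.
by exists A => //; exists set0; [exact: negligible_set0|rewrite setU0].
Qed.

Lemma mu_measurableI (A B : set T) :
  mu_measurable mu A -> mu_measurable mu B -> mu_measurable mu (A `&` B).
Proof.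
move=> [A' /= mA' [N Nn <-]] [B' /= mB' [M Mn <-]].
exists (A' `&` B'); first exact: measurableI.
(* The negligible part consists of the points of the intersection that lie in [N] or [M]. *)
exists ((A' `|` N) `&` (B' `|` M) `&` (N `|` M)).
  apply: (negligibleS (A := N `|` M)); first by move=> x [].
  exact: negligibleU.
apply/seteqP; split=> [x [[? ?]|[]//]|x [[?|?] [?|?]]].
- by split; left.
- by left.
- by right; split; [split; [left|right]|right].
- by right; split; [split; [right|left]|left].
- by right; split; [split; [right|right]|right].
Qed.

Lemma mu_measurableC (A : set T) : mu_measurable mu A ->
  mu_measurable mu (~` A).
Proof.
move=> [A' /= mA' [N [M [mM M0 NM]] <-]].
(* Discarding all of the measurable null set [M] around [N] leaves a Borel set, and what is lost
   lies in [M]. *)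
exists (~` (A' `|` M)); first by apply: measurableC; exact: measurableU.
exists (~` (A' `|` N) `&` M); first by exists M; split => // x [].
apply/seteqP; split=> [x [|[]//]|x AN].
  by move=> AM [?|/NM ?]; apply: AM; [left|right].
have [Mx|Mx] := pselect (M x); first by right.
by left=> -[?|//]; apply: AN; left.
Qed.

Lemma mu_measurable_core (A : set T) : mu_measurable mu A ->
  exists B, [/\ measurable B, B `<=` A & mu.-negligible (A `\` B)].
Proof.
move=> [B /= mB [N Nn <-]]; exists B; split => //.
by apply: negligibleS Nn => x [[]].
Qed.

End OuterNull.

Section ActionSets.
Context (G : groupType) (T : Type) (a : G -> T -> T).
Hypothesis act : is_action a.

Lemma actK g : cancel (a g) (a g^-1%g).
Proof. by move=> x; rewrite -act.2 mulVg act.1. Qed.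

Lemma actVK g : cancel (a g^-1%g) (a g).
Proof. by move=> x; rewrite -act.2 mulgV act.1. Qed.

(** Images are handled as preimages under the inverse, which commute with set operations and
    preserve measurability. *)
Lemma act_image g A : a g @` A = a g^-1%g @^-1` A.
Proof.
apply/seteqP; split=> [_ [x Ax <-]|x Ax]; first by rewrite /preimage/= actK.
by exists (a g^-1%g x) => //; rewrite actVK.
Qed.

Lemma act_image1 A : a 1%g @` A = A.
Proof.
by rewrite act_image invg1; apply/seteqP; split=> x; rewrite /preimage/= act.1.
Qed.

Lemma act_imageM g h A : a (g * h)%g @` A = a g @` (a h @` A).
Proof.
by rewrite image_comp; congr (_ @` _); apply/funext => x/=; rewrite act.2.
Qed.

Lemma act_imageI g A B : a g @` (A `&` B) = a g @` A `&` a g @` B.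
Proof. by rewrite !act_image preimage_setI. Qed.

Lemma act_imageC g A : a g @` (~` A) = ~` (a g @` A).
Proof. by rewrite !act_image preimage_setC. Qed.

End ActionSets.

Section BorelActions.
Context (R : realType) (G : groupType) d (T : measurableType d).
Context (a : G -> T -> T) (mu : {measure set T -> \bar R}).
Hypothesis borel_a : borel_action a.

Lemma act_measurable g A : measurable A -> measurable (a g @` A).
Proof.
move=> mA; rewrite (act_image borel_a.1) -[X in measurable X]setTI.
exact: borel_a.2.
Qed.

Hypothesis mcp_a : mcp a mu.

Lemma act_negligible g A : mu.-negligible (a g @` A) <-> mu.-negligible A.
Proof.
suff H h B : mu.-negligible B -> mu.-negligible (a h @` B).
  split=> [/(H g^-1%g)|/H//].
  by rewrite -(act_imageM borel_a.1) mulVg (act_image1 borel_a.1).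
move=> [N [mN N0 BN]]; exists (a h @` N); split; first exact: act_measurable.
  exact: (mcp_a h mN).1.
exact: image_subset.
Qed.

End BorelActions.

(** * Chaining *)

Section Chaining.
Context (R : realType) (G : groupType) d (X : measurableType d).
Context (mu : probability X R) (a : G -> X -> X).
Hypotheses (countable_G : countable [set: G]).
Hypotheses (borel_a : borel_action a) (mcp_a : mcp a mu).

Lemma setT_non_negligible : ~ mu.-negligible [set: X].
Proof.
move=> muT; have := @probability_setT _ _ _ mu.
by rewrite (measure_negligible measurableT muT) => /eqP; rewrite eq_sym onee_eq0.
Qed.

(** An invariant set is its own only translate, so a chain starting from it cannot reach its
    complement. *)
Lemma chaining_ergodic : chaining a mu -> ergodic a mu.
Proof.
move=> ch A mA iA; apply: contrapT => /not_orP[An cAn].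
have [l [c [_ _]]] : exists l, chains_to a mu l A (~` A).
  by apply: ch; split; [|exact/mu_ext_gt0|exact: mu_measurableC|exact/mu_ext_gt0].
by rewrite iA setICr mu_ext0// ltxx.
Qed.

Lemma group_generating_fixed (Z : Type) (b : G -> Z -> Z) (z : Z) (W : set X) :
  is_action b -> group_generating a mu W ->
  (forall g, ~ mu.-negligible (a g @` W `&` W) -> b g z = z) ->
  forall g, b g z = z.
Proof.
move=> act_b genW fixW g.
(* The stabilizer of [z], as a boolean predicate because [generates] ranges over these. *)
pose H : {pred G} := fun h => `[< b h z = z >].
have HE h : h \in H <-> b h z = z.
  by rewrite unfold_in; split=> [/asboolP|?]; last exact/asboolP.
apply/HE/genW => [|h /mu_ext_gt0/fixW/HE//].
split; first by apply/HE; exact: act_b.1.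
move=> h k /HE hz /HE kz; apply/HE.
by rewrite act_b.2 -{1}kz -(act_b.2 _ k) mulVg act_b.1.
Qed.

(** * Chains and equivariant maps into a metric space *)

Section Spread.
Context (Z : metricType R) (b : G -> Z -> Z) (phi : X -> Z).
Hypothesis isom_b : forall g z w, mdist (b g z) (b g w) = mdist z w.
Hypothesis equiv_phi : forall g x, phi (a g x) = b g (phi x).

(* Each translate of [A] in the chain adds at most the diameter of [phi @` A],
   because the group acts isometrically on [Z]. *)
Lemma chains_to_mdist (k : nat) (A B : set X) (r : R) :
  (forall x y, A x -> A y -> mdist (phi x) (phi y) <= r) ->
  chains_to a mu k A B ->
  exists x y, [/\ A x, B y & mdist (phi x) (phi y) <= r *+ k.+1].
Proof.
move=> diamA [c [c0 cS ck]].
have diam g u v : (a g @` A) u -> (a g @` A) v -> mdist (phi u) (phi v) <= r.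
  by move=> [x Ax <-] [y Ay <-]; rewrite !equiv_phi isom_b; exact: diamA.
have meet (E F : set X) : (0 < (mu^*)%mu (E `&` F))%E -> exists2 x, E x & F x.
  move=> /mu_ext_gt0/negligible_outside/(_ _ (negligible_set0 _)).
  by move=> [x [Ex Fx] _]; exists x.
have reach i x u : (i <= k)%N -> A x -> (a (c i) @` A) u ->
    mdist (phi x) (phi u) <= r *+ i.+1.
  elim: i u => [|i IH] u ik Ax ciu.
    by rewrite mulr1n; apply: (diam (c 0%N)) => //; rewrite c0 (act_image1 borel_a.1).
  have [v civ ciSv] := meet _ _ (cS _ ik).
  rewrite (le_trans (metric_triangle _ (phi v) _))// mulrSr lerD//.
    by apply: IH => //; exact: ltnW.
  exact: (diam (c i.+1)).
have [y cky By] := meet _ _ ck; have [x Ax _] := cky.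
by exists x, y; split => //; exact: reach.
Qed.

Hypothesis sepZ : separable Z.
Hypothesis meas_phi :
  forall B : set Z, <<s @open Z >> B -> mu_measurable mu (phi @^-1` B).

Lemma mdist_open (z : Z) (r : R) : open [set w | mdist z w < r].
Proof.
rewrite openE => w /= zw; rewrite /interior/= -nbhs_ballE.
exists (r - mdist z w); first by rewrite /= subr_gt0.
move=> v; rewrite ballEmdist/= => wv.
by rewrite (le_lt_trans (metric_triangle _ w _))// -ltrBrDl.
Qed.

(** [P z] collects the points of [W] sent within [r] of [z]. Once the null ones among the countably
    many [P z] with [z] in [D] are removed, any two that remain are linked by a chain of length [k],
    which bounds the distance of their images. *)
Lemma chaining_on_near_point (k : nat) (W : set X) (r : R) :
  mu_measurable mu W -> ~ mu.-negligible W -> chaining_on a mu k W -> 0 < r ->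
  exists z, mu.-negligible (W `&` [set x | r *+ (k.*2 + 5) < mdist z (phi x)]).
Proof.
move=> mW Wn chW r0; have [D [cD dD]] := sepZ.
pose P z := W `&` phi @^-1` [set w | mdist z w < r].
have posP z : ~ mu.-negligible (P z) -> positive mu (P z).
  move=> Pn; split; last exact/mu_ext_gt0.
  apply: mu_measurableI => //; apply: meas_phi.
  by apply: sub_gen_smallest; exact: mdist_open.
have near_D x : exists2 z, D z & mdist z (phi x) < r.
  have [||z [zx Dz]] := dD [set w | mdist (phi x) w < r].
  - by exists (phi x); rewrite /= mdistxx.
  - exact: mdist_open.
  - by exists z => //; rewrite metric_sym.
pose D0 := D `&` [set z | mu.-negligible (P z)].
have Nn : mu.-negligible (\bigcup_(z in D0) P z).
  apply: negligible_countable_bigcup => [|z []//].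
  by apply: sub_countable cD; apply: subset_card_le => z [].
have [x0 Wx0 x0N] := negligible_outside Wn Nn.
have [z0 Dz0 z0x0] := near_D x0.
have out z x : D z -> W x -> mdist z (phi x) < r ->
    ~ (\bigcup_(z in D0) P z) x -> ~ mu.-negligible (P z).
  by move=> Dz Wx zx xN Pn; apply: xN; exists z.
exists z0; apply: negligibleS Nn => x [Wx /= far]; apply: contrapT => xN.
have [z Dz zx] := near_D x.
have Pz0 := out _ _ Dz0 Wx0 z0x0 x0N; have Pz := out _ _ Dz Wx zx xN.
have [u v u_ v_|y [w [[Wy zy] [Ww zw] yw]]] :=
  @chains_to_mdist k (P z0) (P z) (r *+ 2) _
    (chW _ _ (posP _ Pz0) (posP _ Pz) (@subIsetl _ _ _) (@subIsetl _ _ _)).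
  rewrite (le_trans (metric_triangle _ z0 _))// mulr2n lerD//.
    by rewrite metric_sym ltW//; case: u_.
  by rewrite ltW//; case: v_.
have : mdist z0 (phi x) <= r *+ (k.*2 + 5).
  rewrite (le_trans (metric_triangle _ (phi y) _))//.
  (* From [z0] to [phi y] costs [r], the chain costs twice [r] for each of its [k.+1] translates,
     and the passage from [phi w] through [z] to [phi x] costs [r] twice. *)
  have -> : (k.*2 + 5 = 1 + (2 * k.+1 + (1 + 1)))%N by lia.
  rewrite !(mulrnDr r) lerD//; first by rewrite mulr1n ltW.
  rewrite (le_trans (metric_triangle _ (phi w) _))// lerD//.
    by rewrite mulrnA.
  rewrite (le_trans (metric_triangle _ z _))// lerD// ltW//.
  by rewrite metric_sym.
by rewrite leNgt far.
Qed.

(** As [k] is the same for all radii, the bounds for the radii 1/(n+1) tend to zero. Off countably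
    many null sets, two points of [W] thus have images at distance zero. *)
Lemma chaining_on_constant (k : nat) (W : set X) :
  mu_measurable mu W -> ~ mu.-negligible W -> chaining_on a mu k W ->
  exists z, mu.-negligible (W `&` [set x | phi x <> z]).
Proof.
move=> mW Wn chW.
have near n := chaining_on_near_point mW Wn chW
  (ltac:(by rewrite invr_gt0) : 0 < n.+1%:R^-1 :> R).
have [z zP] := choice near.
have Nn := negligible_bigcup zP.
have [x0 Wx0 x0N] := negligible_outside Wn Nn.
exists (phi x0); apply: negligibleS Nn => x [Wx /= xx0]; apply: contrapT => xN.
apply: xx0; apply/mdist_positivity/eqP; rewrite eq_le mdist_ge0 andbT.
apply/ler_addgt0Pr => e e0; rewrite add0r.
have bnd n y : W y -> ~ (\bigcup_n (W `&`
    [set x | n.+1%:R^-1 *+ (k.*2 + 5) < mdist (z n) (phi x)])) y ->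
    mdist (z n) (phi y) <= n.+1%:R^-1 *+ (k.*2 + 5).
  by move=> Wy yN; rewrite leNgt; apply/negP => h; apply: yN; exists n.
pose m := (k.*2 + 5)%N.
(* Both points are compared with [z n], hence [m] counts twice. *)
have em0 : 0 < e / (m + m)%:R by rewrite divr_gt0// ltr0n /m; lia.
have [n _ /(_ _ (leqnn n))/= en] := near_infty_natSinv_lt (PosNum em0).
rewrite (le_trans (metric_triangle _ (z n) _))// metric_sym.
rewrite (le_trans (lerD (bnd n _ Wx xN) (bnd n _ Wx0 x0N)))// -mulrnDr.
by rewrite -[leLHS]mulr_natr -ler_pdivlMr ?ltr0n ?(ltW en)// /m; lia.
Qed.

End Spread.

(** Countably many translates of a null set cannot cover almost all of [X]. *)
Lemma complete_section_non_negligible (W : set X) :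
  complete_section a mu W -> ~ mu.-negligible W.
Proof.
move=> csW Wn; apply: setT_non_negligible.
rewrite -(setvU (\bigcup_(g in [set: G]) (a g @` W))); apply: negligibleU => //.
apply: negligible_countable_bigcup => // g _.
exact/(act_negligible borel_a mcp_a).
Qed.

Lemma essentially_boundedly_chaining_metrically_ergodic :
  essentially_boundedly_chaining a mu -> metrically_ergodic a mu.
Proof.
move=> [k [W [mW genW csW chW]]] Z b sepZ act_b isom_b phi meas_phi equiv_phi.
have Wn := complete_section_non_negligible csW.
have [z zP] := chaining_on_constant isom_b equiv_phi sepZ meas_phi mW Wn chW.
(* By equivariance the essential value on the translate of [W] by [g] is [b g z]. *)
have zgP g : mu.-negligible (a g @` W `&` [set x | phi x <> b g z]).
  apply/(act_negligible borel_a mcp_a g^-1%g).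
  rewrite (act_imageI borel_a.1) -(act_imageM borel_a.1) mulVg.
  rewrite (act_image1 borel_a.1) (act_image borel_a.1) invgK.
  apply: negligibleS zP => x [Wx /= h]; split=> //= hx.
  by apply: h; rewrite equiv_phi hx.
have bz := group_generating_fixed act_b genW.
have {}bz : forall g, b g z = z.
  apply: bz => g gW.
  (* A point of the overlap that avoids both null sets has image [z] and [b g z] at once. *)
  have [x [gWx Wx] /not_orP[h1 h2]] := negligible_outside gW (negligibleU zP (zgP g)).
  have xz : phi x = z by apply: contrapT => h; apply: h1.
  by apply: contrapT => h; apply: h2; split => //=; rewrite xz; exact: nesym.
(* Every translate of [W] now has essential value [z], and countably many translates cover almost
   all of [X]. *)
exists z; apply: negligibleS
  (negligibleU csW (negligible_countable_bigcup countable_G (fun g _ => zgP g))).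
move=> x /= xz; have [[g _ gWx]|] := pselect ((\bigcup_(g in [set: G]) (a g @` W)) x).
  by right; exists g => //; split => //=; rewrite bz.
by left.
Qed.

End Chaining.

(** * The space of coin tosses *)

Section FirstDifference.
Variable R : realType.
Implicit Types x y z : nat -> bool.

(** The standard ultrametric of Cantor space, with distance 1/(n+1) for a first disagreement at
    index [n]. *)
Definition first_diff_dist x y : R :=
  match pselect (exists n, x n != y n) with
  | left h => (ex_minn h).+1%:R^-1
  | right _ => 0
  end.

Lemma first_diff_dist_lt x y n :
  first_diff_dist x y < n.+1%:R^-1 <-> forall i, (i <= n)%N -> x i = y i.
Proof.
rewrite /first_diff_dist; case: pselect => [h|h].
  case: ex_minnP => m xm minm; rewrite ltf_pV2 ?posrE// ltr_nat ltnS.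
  split=> [nm i im|xy]; last by rewrite ltnNge; apply/negP => /xy/eqP; apply/negP.
  apply/eqP/negPn/negP => /minm mi; lia.
rewrite invr_gt0; split=> // _ i _.
by apply/eqP/negPn/negP => xi; apply: h; exists i.
Qed.

Lemma first_diff_dist_ge x y n : x n != y n -> n.+1%:R^-1 <= first_diff_dist x y.
Proof.
by move=> xy; rewrite leNgt; apply/negP => /first_diff_dist_lt/(_ n (leqnn n))/eqP;
  apply/negP.
Qed.

Lemma first_diff_dist_ge0 x y : 0 <= first_diff_dist x y.
Proof. by rewrite /first_diff_dist; case: pselect. Qed.

Lemma first_diff_distxx x : first_diff_dist x x = 0.
Proof.
rewrite /first_diff_dist; case: pselect => // h; exfalso.
by case: h => n; rewrite eqxx.
Qed.

Lemma first_diff_dist_positivity x y : first_diff_dist x y = 0 -> x = y.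
Proof.
move=> xy0; apply/funext => n; apply/eqP/negPn/negP => /first_diff_dist_ge.
by rewrite xy0 leNgt invr_gt0 ltr0n.
Qed.

Lemma first_diff_dist_sym x y : first_diff_dist x y = first_diff_dist y x.
Proof.
suff H u v : first_diff_dist u v <= first_diff_dist v u.
  by apply/eqP; rewrite eq_le !H.
rewrite {1}/first_diff_dist; case: pselect => [h|_]; last exact: first_diff_dist_ge0.
by case: ex_minnP => m um _; apply: first_diff_dist_ge; rewrite eq_sym.
Qed.

(** Where [x] and [z] first differ, [y] differs from one of them, so one summand alone is large
    enough. *)
Lemma first_diff_dist_triangle y x z :
  first_diff_dist x z <= first_diff_dist x y + first_diff_dist y z.
Proof.
rewrite {1}/first_diff_dist; case: pselect => [h|_]; last first.
  by rewrite addr_ge0// first_diff_dist_ge0.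
case: ex_minnP => m xzm _; have [xym|/first_diff_dist_ge xym] := eqVneq (x m) (y m).
  rewrite -[leLHS]add0r lerD// ?first_diff_dist_ge0//.
  by apply: first_diff_dist_ge; rewrite -xym.
by rewrite -[leLHS]addr0 lerD// first_diff_dist_ge0.
Qed.

End FirstDifference.

(** The parameter [R] only records where the metric takes its values. *)
Definition coins (R : realType) : Type := nat -> bool.

HB.instance Definition _ (R : realType) := Pointed.copy (coins R) (nat -> bool).
HB.instance Definition _ (R : realType) := isMetric.Build R (coins R)
  (@first_diff_distxx R) (@first_diff_dist_positivity R)
  (@first_diff_dist_sym R) (@first_diff_dist_triangle R).

Definition cylinder (s : seq bool) : set (nat -> bool) :=
  [set y | forall i, (i < size s)%N -> y i = nth false s i].

Section CoinSpace.
Variable R : realType.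
Implicit Types (x y : coins R) (s t : seq bool).

Lemma coins_ball x n :
  ball x (n.+1%:R^-1 : R) = [set y | forall i, (i <= n)%N -> x i = y i].
Proof.
by rewrite ballEmdist; apply/seteqP; split=> y /=; rewrite first_diff_dist_lt.
Qed.

Lemma ball_cylinder x n : ball x (n.+1%:R^-1 : R) = cylinder (mkseq x n.+1).
Proof.
rewrite coins_ball; apply/seteqP; split=> y /= xy i.
  by rewrite size_mkseq ltnS => ni; rewrite nth_mkseq// xy.
by move=> ni; have := xy i; rewrite size_mkseq ltnS nth_mkseq// => ->.
Qed.

Lemma small_ball (e : R) : 0 < e ->
  exists n, forall x, ball x n.+1%:R^-1 `<=` ball x e.
Proof.
move=> e0; have [n _ /(_ _ (leqnn n))/= en] := near_infty_natSinv_lt (PosNum e0).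
by exists n => x; apply: le_ball; exact: ltW.
Qed.

Lemma open_cylinderP (O : set (coins R)) : open O <->
  forall x, O x -> exists n, cylinder (mkseq x n) `<=` O.
Proof.
split=> [+ x Ox|OP].
  rewrite openE => /(_ x Ox); rewrite /interior/= -nbhs_ballE.
  move=> [e /= e0 eO]; have [n nP] := small_ball e0; exists n.+1.
  by rewrite -ball_cylinder; exact: subset_trans eO.
rewrite openE => x /OP[n nO]; rewrite /interior/= -nbhs_ballE.
(* The ball of radius 1/(n+1) fixes [n.+1] coordinates, one more than the cylinder asks for. *)
exists n.+1%:R^-1; first by rewrite /= invr_gt0.
move=> y; rewrite ball_cylinder => xy; apply: nO => i.
rewrite size_mkseq => ni; have := xy i; rewrite size_mkseq !nth_mkseq//; last lia.
by apply; lia.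
Qed.

Lemma open_cylinder s : open (cylinder s : set (coins R)).
Proof.
apply/open_cylinderP => x xs; exists (size s) => y xy i si.
by rewrite -xs// xy ?nth_mkseq// size_mkseq.
Qed.

(** Finite words padded with [false] are dense. *)
Lemma coins_separable : separable (coins R).
Proof.
exists (range (fun t : seq bool => nth false t : coins R)); split.
  by apply: sub_countable (card_image_le _ _) _; exact: countableP.
move=> O [x Ox] /open_cylinderP/(_ x Ox)[n nO].
exists (nth false (mkseq x n)); split; last by exists (mkseq x n).
exact: nO.
Qed.

(** Take a ball of radius 1/(n+1) in [F] for each [n]. Any two of them meet, so their centres agree
    on the coordinates fixed by both, and the diagonal of the centres is the limit. *)
Lemma coins_complete (F : set_system (coins R)) : ProperFilter F -> cauchy F ->
  exists p : coins R, F --> p.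
Proof.
move=> PF /cauchyP cF.
have /choice[c cP] n : exists x, F (ball x (n.+1%:R^-1 : R)).
  by apply: cF; rewrite invr_gt0.
have agree n i : (i <= n)%N -> c n i = c i i.
  move=> ni; have [z] := filter_ex (filterI (cP n) (cP i)).
  by rewrite !coins_ball => -[/(_ i ni)-> /(_ i (leqnn i))].
exists (fun n => c n n : bool) => A; rewrite /= -nbhs_ballE => -[e /= e0 eA].
have [n nP] := small_ball e0; apply: filterS (cP n) => y.
rewrite coins_ball => cy; apply/eA/nP; rewrite coins_ball => i ni.
by rewrite -(agree n)// cy.
Qed.

Definition coin_space := g_sigma_algebraType (@open (coins R)).

Lemma coin_space_standard : standard_borel R coin_space.
Proof.
exists (coins R), id; split; [exact: coins_separable|exact: coins_complete| |].
  by exists id.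
by move=> A; rewrite image_id.
Qed.

(** The empty set is added to make the family closed under intersections. *)
Definition cylinders : set (set coin_space) :=
  [set A | A = set0 \/ exists s, A = cylinder s].

Lemma cylinder_measurable s : measurable (cylinder s : set coin_space).
Proof. by apply: sub_sigma_algebra; exact: open_cylinder. Qed.

Lemma cylinderS s t : (size s <= size t)%N ->
  cylinder t `<=` cylinder s \/ cylinder s `&` cylinder t = set0.
Proof.
move=> st.
have [e|ne] := pselect (forall i, (i < size s)%N -> nth false t i = nth false s i).
  by left=> y yt i si; rewrite yt ?e//; exact: leq_trans st.
right; apply/seteqP; split=> // y [ys yt]; apply: ne => i si.
by rewrite -ys// -yt//; exact: leq_trans st.
Qed.

Lemma cylinders_setI : setI_closed cylinders.
Proof.
move=> A B [->|[s ->]]; first by left; rewrite set0I.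
move=> [->|[t ->]]; first by left; rewrite setI0.
have [st|/ltnW ts] := leqP (size s) (size t).
  have [h|h] := cylinderS st; last by left.
  by right; exists t; rewrite setIidr.
have [h|h] := cylinderS ts; last by left; rewrite setIC.
by right; exists s; rewrite setIidl.
Qed.

Lemma cylinders_generate : @measurable _ coin_space = <<s cylinders >>.
Proof.
apply/seteqP; split; last first.
  apply: smallest_sub; first exact: sigma_algebra_measurable.
  by move=> _ [->|[s ->]]; [exact: measurable0|exact: cylinder_measurable].
apply: smallest_sub; first exact: smallest_sigma_algebra.
move=> O /open_cylinderP oO.
pose GT := g_sigma_algebraType cylinders.
(* An open set is the union of the cylinders inside it, and there are only countably many finite
   words. *)
have -> : O = \bigcup_s (if `[< cylinder s `<=` O >] then cylinder s else set0).
  apply/seteqP; split=> [x Ox|x [s _]]; last by case: ifP => // /asboolP; apply.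
  have [n nO] := oO _ Ox; exists (mkseq x n) => //; case: asboolP => // _ i.
  by rewrite size_mkseq => ni; rewrite nth_mkseq.
apply: (@countable_bigcupT_measurable _ GT) => [|s]; first exact: countableP.
by apply: sub_sigma_algebra; case: ifP => _; [right; exists s|left].
Qed.

Lemma cylinder_nil : cylinder [::] = setT.
Proof. by apply/seteqP; split. Qed.

Lemma cylinders_measure_unique (m1 m2 : {measure set coin_space -> \bar R}) :
  (m1 setT < +oo)%E -> (forall s, m1 (cylinder s) = m2 (cylinder s)) ->
  forall A, measurable A -> m1 A = m2 A.
Proof.
move=> m1T m12; apply: (measure_unique cylinders (fun=> setT)) => //.
- exact: cylinders_generate.
- exact: cylinders_setI.
- by move=> _; right; exists [::]; rewrite cylinder_nil.
- exact: bigcup_const.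
- by move=> _ [->|[s ->]//]; rewrite !measure0.
Qed.

Lemma coordinate_measurable n : measurable [set y : coin_space | y n].
Proof.
apply: sub_sigma_algebra; apply/open_cylinderP => x /= xn.
exists n.+1 => y xy /=; rewrite (_ : y n = x n)//.
by have := xy n; rewrite size_mkseq nth_mkseq//; exact.
Qed.

(** The preimage of a cylinder is a finite intersection of the given sets and their complements,
    written as a countable one with [setT] beyond the length of the word. *)
Lemma measurable_fun_coins d (T : measurableType d) (f : T -> coin_space) :
  (forall n, measurable [set t | f t n]) -> measurable_fun setT f.
Proof.
move=> mf; apply: (measurability cylinders cylinders_generate).
move=> _ [_ [->|[s ->]] <-]; first by rewrite preimage_set0 setI0.
rewrite setTI (_ : _ @^-1` _ = \bigcap_i (if (i < size s)%N then
    (if nth false s i then [set t | f t i] else ~` [set t | f t i]) else setT)).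
  by apply: bigcapT_measurable => i; case: ifP => // _; case: ifP => // _;
    exact: measurableC.
apply/seteqP; split=> [t ts i _|t ts i si].
  by case: ifP => // si; have /= := ts i si; case: ifP => _ /= ->.
by have := ts i Logic.I; rewrite si; case: ifP => _ /=; [|move/negP/negbTE].
Qed.

Lemma reindex_measurable (sg : nat -> nat) :
  measurable_fun setT (fun y : coin_space => (y \o sg : coin_space)).
Proof. by apply: measurable_fun_coins => n; exact: coordinate_measurable. Qed.

Definition flip n (y : coin_space) : coin_space :=
  fun i => if i == n then ~~ y i else y i.

Lemma flip_measurable n : measurable_fun setT (flip n).
Proof.
apply: measurable_fun_coins => i; rewrite /flip; case: eqP => _.
  rewrite (_ : mkset _ = ~` [set y : coin_space | y i]).
    by apply: measurableC; exact: coordinate_measurable.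
  by apply/seteqP; split=> y /= /negP.
exact: coordinate_measurable.
Qed.

(** By injectivity, coordinate [sg n] is read at position [n] only. *)
Lemma flip_reindex n (sg : nat -> nat) (y : coin_space) : injective sg ->
  flip n (y \o sg : coin_space) = flip (sg n) y \o sg.
Proof.
by move=> isg; apply/funext => i; rewrite /flip/= (inj_eq isg).
Qed.

Lemma flip_cylinder n s :
  flip n @^-1` cylinder s = cylinder (mkseq (flip n (nth false s)) (size s)).
Proof.
apply/seteqP; split=> y ys i; rewrite ?size_mkseq => si.
  by rewrite nth_mkseq//; have := ys i si; rewrite /flip; case: eqP => // _ <-; rewrite negbK.
have := ys i; rewrite size_mkseq nth_mkseq// => /(_ si).
by rewrite /flip; case: eqP => // _ ->; rewrite negbK.
Qed.

Lemma flip_cylinder_ge n s : (size s <= n)%N -> flip n @^-1` cylinder s = cylinder s.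
Proof.
move=> sn; rewrite flip_cylinder; congr cylinder.
apply: (@eq_from_nth _ false); rewrite size_mkseq// => i si.
by rewrite nth_mkseq// /flip; case: eqP => // ?; lia.
Qed.

Definition flip_invariant (m : set coin_space -> \bar R) :=
  forall n A, measurable A -> m (flip n @^-1` A) = m A.

Lemma cylinder_rcons s b :
  cylinder (rcons s b) = cylinder s `&` [set y | y (size s) = b].
Proof.
apply/seteqP; split=> [y ys|y [ys /= yb] i].
  split=> [i si|/=]; first by rewrite ys ?nth_rcons ?si// size_rcons; lia.
  by rewrite ys ?nth_rcons ?ltnn ?eqxx// size_rcons.
rewrite size_rcons ltnS leq_eqVlt nth_rcons => /orP[/eqP->|si].
  by rewrite ltnn eqxx.
by rewrite si ys.
Qed.

(** The flip at position [size s] exchanges the two one-letter extensions of [s], so each carries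
    half the mass of the cylinder of [s]. *)
Lemma flip_invariant_cylinder (m : {measure set coin_space -> \bar R}) :
  flip_invariant m -> forall s, m (cylinder s) = (m setT * (2^-1 ^+ size s)%:E)%E.
Proof.
move=> fm; elim/last_ind=> [|s b IH]; first by rewrite cylinder_nil/= expr0 mule1.
have flipb : flip (size s) @^-1` cylinder (rcons s b) = cylinder (rcons s (~~ b)).
  rewrite !cylinder_rcons preimage_setI flip_cylinder_ge//.
  congr (_ `&` _); apply/seteqP; split=> y /=; rewrite /flip eqxx.
    by move=> <-; rewrite negbK.
  by move=> ->; rewrite negbK.
have eqb := fm (size s) _ (cylinder_measurable (rcons s b)).
rewrite flipb in eqb.
have cs : cylinder s = cylinder (rcons s b) `|` cylinder (rcons s (~~ b)).
  rewrite !cylinder_rcons -setIUr (_ : _ `|` _ = setT) ?setIT//.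
  by apply/seteqP; split=> // y _ /=; case: (y _); case: (b); [left|right|right|left].
have {}cs : m (cylinder s) = (2%:R%:E * m (cylinder (rcons s b)))%E.
  transitivity (m (cylinder (rcons s b)) + m (cylinder (rcons s (~~ b))))%E.
    rewrite cs; apply: measureU; [exact: cylinder_measurable|exact: cylinder_measurable|].
    rewrite !cylinder_rcons; apply/seteqP; split=> // y [[_ /= ->] [_ /=]].
    by case: (b).
  by rewrite mule_natl mule2n eqb.
rewrite size_rcons exprSr EFinM muleA -IH cs muleAC -EFinM divff// mul1e.
by [].
Qed.

End CoinSpace.

Lemma probability_setT_lty d (T : measurableType d) (R : realType)
  (P : probability T R) : (P setT < +oo)%E.
Proof. by rewrite probability_setT ltey. Qed.

(** * Binary digits and the fair coin measure *)

Section BinaryDigits.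
Variable R : realType.

Definition doubling (x : R) : R := if 2^-1 <= x then x * 2 - 1 else x * 2.

Definition digits (x : measurableTypeR R) : coin_space R :=
  fun n => 2^-1 <= iter n doubling x.

(** The number with binary expansion [s] after the point: the left end of the dyadic interval whose
    points have digits beginning with [s]. *)
Fixpoint dyadic (s : seq bool) : R :=
  if s is b :: t then (b%:R + dyadic t) / 2 else 0.

Lemma dyadic_ge0 s : 0 <= dyadic s.
Proof. by elim: s => //= b s IH; rewrite divr_ge0// addr_ge0. Qed.

Lemma dyadic_le s : dyadic s + 2^-1 ^+ size s <= 1.
Proof.
elim: s => [|b s IH] /=; first by rewrite expr0 add0r.
by rewrite exprS; case: b => /=; lra.
Qed.

(** The first digit tells the half of the unit interval, and [doubling] maps each half affinely onto
    the whole. *)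
Lemma digits_cylinder s x : 0 <= x < 1 ->
  cylinder s (digits x) <-> dyadic s <= x < dyadic s + 2^-1 ^+ size s.
Proof.
elim: s x => [|b s IH] x x01; first by rewrite /= expr0 add0r x01; split.
have Tx01 : 0 <= doubling x < 1 by rewrite /doubling; case: ifP; lra.
have -> : cylinder (b :: s) (digits x) <->
    (2^-1 <= x) = b /\ cylinder s (digits (doubling x)).
  split=> [c|[cb c] [|i]//= si].
    by split=> [|i si]; [exact: (c 0%N)|have := c i.+1 si; rewrite /digits iterSr].
  by rewrite /digits iterSr; exact: c.
rewrite IH//= exprS /doubling; move: (dyadic_ge0 s) (dyadic_le s).
by case: (b) => /=; case: (leP 2^-1 x) => hx d0 d1; split=> [[//]|]; lra.
Qed.

Lemma measurable_doubling : measurable_fun setT doubling.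
Proof.
apply: measurable_fun_ifT.
- exact: measurable_fun_ler.
- by apply: measurable_funB => //; exact: measurable_funM.
- exact: measurable_funM.
Qed.

Lemma measurable_digits : measurable_fun setT digits.
Proof.
apply: measurable_fun_coins => n.
have mn : measurable_fun setT (iter n doubling).
  elim: n => [|n IH]; first exact: measurable_id.
  by apply: measurableT_comp IH; exact: measurable_doubling.
rewrite -[X in measurable X]setTI (_ : [set _ | _] = iter n doubling @^-1` `[2^-1, +oo[).
  exact: mn.
by apply/seteqP; split=> x /=; rewrite in_itv/= andbT.
Qed.

HB.instance Definition _ := isMeasurableFun.Build _ _ _ _ digits measurable_digits.

Definition unit_lebesgue : set (measurableTypeR R) -> \bar R :=
  mrestr lebesgue_measure (measurable_itv `[0%R, 1%R[).

HB.instance Definition _ := Measure.on unit_lebesgue.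

Lemma unit_lebesgue_setT : unit_lebesgue setT = 1%E.
Proof.
by rewrite /unit_lebesgue/mrestr setTI lebesgue_measure_itv/= lte_fin ltr01 sube0.
Qed.

HB.instance Definition _ :=
  Measure_isProbability.Build _ _ _ unit_lebesgue unit_lebesgue_setT.

(** The image of Lebesgue measure under [digits]: cylinders pull back to dyadic intervals of the
    right length. *)
Lemma coin_exists : exists P : probability (coin_space R) R,
  forall s, P (cylinder s) = (2^-1 ^+ size s)%:E.
Proof.
exists (distribution unit_lebesgue digits) => s.
rewrite /= /distribution /pushforward /unit_lebesgue /mrestr.
rewrite (_ : _ `&` _ = `[dyadic s, dyadic s + 2^-1 ^+ size s[%classic).
  rewrite lebesgue_measure_itv/= lte_fin ltrDl exprn_gt0 ?invr_gt0//.
  by rewrite -EFinD addrAC subrr add0r.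
apply/seteqP; split=> x /=; rewrite !in_itv/=.
  by move=> [xs x01]; apply/(digits_cylinder s).
move=> xs; have x01 : 0 <= x < 1.
  by move: (dyadic_ge0 s) (dyadic_le s) xs; lra.
by split=> //; apply/digits_cylinder.
Qed.

Definition coin : probability (coin_space R) R := projT1 (cid coin_exists).

Lemma coin_cylinder s : coin (cylinder s) = (2^-1 ^+ size s)%:E.
Proof. exact: (projT2 (cid coin_exists)). Qed.

End BinaryDigits.

(** * Flip invariance characterizes the coin measure *)

Section CoinMeasure.
Variable R : realType.
Local Notation Y := (coin_space R).
Local Notation coin := (coin R).
Local Open Scope ereal_scope.

Lemma flip_preimage_measurable n (A : set Y) :
  measurable A -> measurable (flip n @^-1` A).
Proof. by move=> mA; rewrite -[X in measurable X]setTI; exact: flip_measurable. Qed.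

Lemma flip_invariant_unique (m : {measure set Y -> \bar R}) :
  m setT < +oo -> flip_invariant m ->
  forall A, measurable A -> m A = m setT * coin A.
Proof.
move=> mT fm A mA; have mTfin : m setT \is a fin_num by rewrite ge0_fin_numE.
have r0 : (0 <= fine (m setT))%R by exact: fine_ge0.
transitivity (mscale (NngNum r0) coin A); last by rewrite /mscale/= fineK.
apply: cylinders_measure_unique => // s.
transitivity ((fine (m setT))%:E * coin (cylinder s)) => //.
by rewrite (flip_invariant_cylinder fm) fineK// coin_cylinder.
Qed.

Lemma coin_flip : flip_invariant coin.
Proof.
move=> n A mA; pose f := mfun_Sub (mem_set (@flip_measurable R n)).
transitivity (distribution coin f A) => //.
apply: cylinders_measure_unique => //.
  exact: (probability_setT_lty (distribution coin f)).
move=> s; transitivity (coin (@flip R n @^-1` cylinder s)) => //.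
by rewrite flip_cylinder coin_cylinder size_mkseq; exact/esym/coin_cylinder.
Qed.

(** Flipping the reindexed sequence at [n] amounts to flipping the original at [sg n]. The image
    measure is therefore flip invariant, and uniqueness identifies it. *)
Lemma coin_reindex (sg : nat -> nat) (A : set Y) : injective sg -> measurable A ->
  coin ((fun y : Y => y \o sg : Y) @^-1` A) = coin A.
Proof.
move=> isg mA; pose f := mfun_Sub (mem_set (@reindex_measurable R sg)).
transitivity (distribution coin f A) => //.
have reindex_preimage_measurable B : measurable B ->
    measurable ((fun y : Y => y \o sg : Y) @^-1` B).
  by move=> mB; rewrite -[X in measurable X]setTI; exact: reindex_measurable.
have fi : flip_invariant (distribution coin f).
  move=> n B mB; transitivity
    (coin (flip (sg n) @^-1` ((fun y : Y => y \o sg : Y) @^-1` B))).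
    by congr (coin _); apply/seteqP; split=> y; rewrite /preimage/= flip_reindex.
  by rewrite coin_flip//; exact: reindex_preimage_measurable.
transitivity (distribution coin f setT * coin A).
  exact: flip_invariant_unique (probability_setT_lty (distribution coin f)) fi A mA.
by rewrite (probability_setT (distribution coin f)) mul1e.
Qed.

End CoinMeasure.

(** * The zero-one law *)

Section ZeroOne.
Variable R : realType.
Local Notation Y := (coin_space R).
Local Notation coin := (coin R).
Local Open Scope ereal_scope.

Lemma measurableY d (T : measurableType d) (A B : set T) :
  measurable A -> measurable B -> measurable (A `+` B).
Proof. by move=> mA mB; apply: measurableU; exact: measurableD. Qed.

Lemma le_measureU d (T : measurableType d) (mu : {measure set T -> \bar R})
    (A B C : set T) :
  measurable A -> measurable B -> measurable C -> A `<=` B `|` C ->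
  mu A <= mu B + mu C.
Proof.
move=> mA mB mC ABC; apply: le_trans (measureU2 _ mB mC).
by apply: le_measure; rewrite ?inE//; exact: measurableU.
Qed.

Lemma measurable_flip_setY n (A : set Y) : measurable A ->
  measurable (A `+` flip n @^-1` A).
Proof. by move=> mA; apply: measurableY => //; exact: flip_preimage_measurable. Qed.

(* A measurable set is almost determined by finitely many coordinates, so that
   flipping a far away coordinate hardly moves it. *)
Lemma flip_far (A : set Y) : measurable A -> forall e : R, (0 < e)%R ->
  exists N, forall n, (N <= n)%N -> coin (A `+` flip n @^-1` A) <= e%:E.
Proof.
pose far := [set E : set Y | measurable E /\ forall e : R, (0 < e)%R ->
  exists N, forall n, (N <= n)%N -> coin (E `+` flip n @^-1` E) <= e%:E].
suff H : <<s @cylinders R >> `<=` far.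
  by move=> mA; have [] : far A by apply: H; rewrite -cylinders_generate.
have far_cyl s : far (cylinder s).
  split=> [|e e0]; first exact: cylinder_measurable.
  exists (size s) => n sn; rewrite flip_cylinder_ge// setYK measure0.
  by rewrite lee_fin ltW.
(* By Dynkin's theorem it suffices that [far] contains the cylinders and is a lambda-system. *)
apply: (lambda_system_subset (@cylinders_setI R)) => //; last first.
  move=> _ [->|[s ->]//]; split=> // e e0; exists 0%N => n _.
  by rewrite preimage_set0 setYK measure0 lee_fin ltW.
split=> //.
- by rewrite -cylinder_nil; exact: far_cyl.
- move=> E F FE [mE farE] [mF farF]; split; first exact: measurableD.
  move=> e e0; have e20 : (0 < e / 2)%R by rewrite divr_gt0.
  have [N NP] := farE _ e20; have [M MP] := farF _ e20.
  exists (maxn N M) => n; rewrite geq_max => /andP[Nn Mn].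
  (* A flip that changes membership in the difference changes membership in [E] or in [F], so each
     is given half of [e]. *)
  rewrite [e in leRHS]splitr EFinD.
  apply: le_trans (leeD (NP n Nn) (MP n Mn)).
  apply: le_measureU; try exact: measurable_flip_setY.
    by apply: measurable_flip_setY; exact: measurableD.
  move=> y; rewrite /setY/setU/setD/preimage/=.
  have := pselect (E y); have := pselect (E (flip n y)).
  have := pselect (F y); have := pselect (F (flip n y)); tauto.
- move=> F ndF farF; have mF k : measurable (F k) by case: (farF k).
  have mUF : measurable (\bigcup_k F k) by exact: bigcupT_measurable.
  split=> // e e0; pose E := \bigcup_k F k.
  have e30 : (0 < e / 3)%R by rewrite divr_gt0.
  have cvgD : coin (E `\` F k) @[k --> \oo] --> 0.
    rewrite -(measure0 coin) -(_ : \bigcap_k (E `\` F k) = set0); last first.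
      apply/seteqP; split=> // y yE; have [[k _ Fy] _] := yE 0%N Logic.I.
      by have [_] := yE k Logic.I.
    apply: (@nonincreasing_cvg_mu _ _ _ coin (fun k => E `\` F k)).
    - apply: le_lt_trans (probability_setT_lty coin).
      by apply: le_measure; rewrite ?inE//; exact: measurableD.
    - by move=> k; exact: measurableD.
    - by apply: bigcapT_measurable => k; exact: measurableD.
    - by move=> i j ij; apply/subsetPset; apply: setDS; exact/subsetPset/ndF.
  have /cvgD[k _ /(_ k (leqnn k))/= Fk] : nbhs 0 [set y : \bar R | y < (e / 3)%:E].
    by apply: open_nbhs_nbhs; split; [exact: open_ereal_lt_ereal|rewrite /= lte_fin].
  have [N NP] := (farF k).2 _ e30; exists N => n /NP farn.
  have mEF : measurable (E `\` F k) by exact: measurableD.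
  have mfEF := flip_preimage_measurable n mEF.
  (* Replacing the union by [F k] costs [e / 3] before the flip and again after it; flipping [F k]
     itself costs the last third. *)
  have -> : e%:E = (e / 3)%:E + (e / 3)%:E + (e / 3)%:E.
    by rewrite -!EFinD; congr (_%:E); lra.
  have fFk : coin (flip n @^-1` (E `\` F k)) <= (e / 3)%:E.
    by rewrite coin_flip//; exact: ltW.
  apply: le_trans (leeD (leeD (ltW Fk) fFk) farn).
  apply: le_trans (leeD (measureU2 _ mEF mfEF) (lexx _)).
  apply: le_measureU; try exact: measurable_flip_setY.
    exact: measurableU.
  move=> y; rewrite /setY/setU/setD/preimage/=.
  have FE z : F k z -> E z by exists k.
  have := FE y; have := FE (flip n y).
  have := pselect (F k y); have := pselect (F k (flip n y)); rewrite /E; tauto.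
Qed.

Section CoordinateAction.
Context (G : groupType) (p : G -> nat -> nat).
Hypothesis act_p : is_action p.

(** Precomposition reverses products; the inverse restores a left action. *)
Definition coordinate_action (g : G) (y : Y) : Y := y \o p g^-1%g.

Lemma coordinate_action_borel : borel_action coordinate_action.
Proof.
split=> [|g]; last exact: reindex_measurable.
split=> [y|g h y]; apply/funext => i; rewrite /coordinate_action/=.
  by rewrite invg1 act_p.1.
by rewrite invgM act_p.2.
Qed.

Lemma coin_coordinate_action_pre g (A : set Y) : measurable A ->
  coin (coordinate_action g @^-1` A) = coin A.
Proof. by apply: coin_reindex; exact: can_inj (actK act_p g^-1%g). Qed.

Lemma coordinate_action_pmp : pmp coordinate_action coin.
Proof.
move=> A g mA; rewrite (act_image coordinate_action_borel.1).
exact: coin_coordinate_action_pre.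
Qed.

Lemma flip_coordinate_action g n (y : Y) :
  flip n (coordinate_action g y) = coordinate_action g (flip (p g^-1%g n) y).
Proof. by apply: flip_reindex; exact: can_inj (actK act_p g^-1%g). Qed.

Lemma coordinate_preimage_measurable g (A : set Y) :
  measurable A -> measurable (coordinate_action g @^-1` A).
Proof.
by move=> mA; rewrite -[X in measurable X]setTI; exact: coordinate_action_borel.2.
Qed.

Hypothesis trans_p : forall i j, exists g, p g i = j.

(* The distance from [A] to its flip at [n] does not depend on [n], because the
   group permutes the flips transitively, and it vanishes as [n] grows. *)
Lemma almost_invariant_flip (A : set Y) : measurable A ->
  (forall g, coin (A `+` coordinate_action g @^-1` A) = 0) ->
  forall n, coin (A `+` flip n @^-1` A) = 0.
Proof.
move=> mA iA; have le_flip g n :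
    coin (A `+` flip (p g^-1%g n) @^-1` A) <= coin (A `+` flip n @^-1` A).
  set m := p _ _; pose B := coordinate_action g @^-1` A.
  have mB : measurable B := coordinate_preimage_measurable g mA.
  have mAB : measurable (A `+` B) by exact: measurableY.
  have mAf := measurable_flip_setY n mA.
  (* The two zeros become the masses of the symmetric difference of [A] and [B] and of its flip at
     [m]; the last term is pulled back by [g]. Together these three sets cover what the flip at [m]
     moves. *)
  rewrite -[leRHS]add0e -[X in X + _](adde0 0) -{1}(iA g) -(iA g).
  rewrite -[X in (_ + X) + _](@coin_flip R m _ mAB).
  rewrite -[X in _ + X](@coin_coordinate_action_pre g _ mAf).
  have mfAB := flip_preimage_measurable m mAB.
  have mgAf := coordinate_preimage_measurable g mAf.
  apply: le_trans (leeD (measureU2 _ mAB mfAB) (lexx _)).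
  apply: le_measureU => //; [exact: measurable_flip_setY|exact: measurableU|].
  move=> y; rewrite /B/setY/setU/setD/preimage/=.
  rewrite flip_coordinate_action -/m.
  have := pselect (A (coordinate_action g y)).
  have := pselect (A (coordinate_action g (flip m y))).
  have := pselect (A y); have := pselect (A (flip m y)); tauto.
move=> m; apply/eqP; rewrite eq_le measure_ge0 andbT.
apply/lee_addgt0Pr => e e0; rewrite add0e.
have [N /(_ N (leqnn N)) NP] := flip_far mA e0; apply: le_trans NP.
have [g gm] := trans_p N m; have := le_flip g^-1%g N; by rewrite invgK gm.
Qed.

(** The restriction of [coin] to [A] is flip invariant, hence equal to [coin] scaled by [coin A].
    Evaluated at [A], this says that [coin A] is its own square. *)
Lemma flip_null_zero_one (A : set Y) : measurable A ->
  (forall n, coin (A `+` flip n @^-1` A) = 0) -> coin A = 0 \/ coin A = 1.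
Proof.
move=> mA fA; have fi : flip_invariant (mrestr coin mA).
  move=> n B mB; rewrite /mrestr.
  have mfB := flip_preimage_measurable n mB.
  have mfA := flip_preimage_measurable n mA.
  have mAf := measurable_flip_setY n mA.
  rewrite -(@coin_flip R n (B `&` A)); last exact: measurableI.
  rewrite preimage_setI; apply/eqP; rewrite eq_le.
  rewrite -[X in _ <= X]adde0 -[X in _ && (_ <= X)]adde0 -(fA n).
  apply/andP; split; apply: le_measureU; try exact: measurableI; try exact: mAf;
    move=> y; rewrite /setY/setU/setD/setI/preimage/=;
    have := pselect (A y); have := pselect (A (flip n y)); tauto.
have AT : mrestr coin mA setT = coin A by rewrite /mrestr setTI.
have : mrestr coin mA A = mrestr coin mA setT * coin A.
  apply: flip_invariant_unique => //.
  change (mrestr coin mA setT < +oo); rewrite AT.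
  apply: le_lt_trans (probability_setT_lty coin).
  by apply: le_measure; rewrite ?inE.
rewrite AT /mrestr setIid.
have : coin A \is a fin_num by exact: fin_num_measure.
case: (coin A) => // r _; rewrite -EFinM => -[rr].
have /eqP : (r * (1 - r) = 0)%R by rewrite mulrBr mulr1 -rr subrr.
by rewrite mulf_eq0 subr_eq0 => /orP[/eqP->|/eqP<-]; [left|right].
Qed.

(** The set itself is strictly invariant, so its Borel part [B] is invariant up to [N] and a
    translate of [N], which is enough for the zero-one law. *)
Lemma coin_ergodic : ergodic coordinate_action coin.
Proof.
move=> A [B /= mB [M [N [mN N0 MN]] <-]] iA.
have iAV g y : (B `|` M) (coordinate_action g y) <-> (B `|` M) y.
  by rewrite -{2}(iA g^-1%g) (act_image coordinate_action_borel.1) invgK.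
have iB g : coin (B `+` coordinate_action g @^-1` B) = 0.
  have mgN := coordinate_preimage_measurable g mN.
  have gN0 : coin (coordinate_action g @^-1` N) = 0.
    by rewrite -[RHS]N0; exact: coin_coordinate_action_pre.
  apply: measure_negligible.
    by apply: measurableY => //; exact: coordinate_preimage_measurable.
  apply: (negligibleS (A := N `|` coordinate_action g @^-1` N)); last first.
    by apply: negligibleU; [exists N; split|exists (coordinate_action g @^-1` N); split].
  move=> y; have := iAV g y; have := MN y; have := MN (coordinate_action g y).
  rewrite /setY/setU/setD/preimage/=.
  have := pselect (B y); have := pselect (B (coordinate_action g y)); tauto.
have [B0|B1] := flip_null_zero_one mB (almost_invariant_flip mB iB); [left|right].
  by apply: negligibleU; [exists B; split|exists N; split].
exists (~` B); split; first exact: measurableC.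
  by rewrite probability_setC// B1 subee.
by move=> y /= h By; apply: h; left.
Qed.

End CoordinateAction.
End ZeroOne.

(** * Ergodic actions attached to a subgroup *)

Section Cosets.
Context (G : groupType) (H : set G).
Hypothesis countable_G : countable [set: G].
Hypotheses (H1 : H 1%g) (HM : forall g h, H g -> H h -> H (g * h)%g).
Hypothesis HV : forall g, H g -> H g^-1%g.

(** Left cosets of [H] receive all naturals or an initial segment as numbers, so that they can index
    coin tosses. *)
Definition coset_numbering (q : G -> nat) :=
  (forall g h, q g = q h <-> H (g^-1 * h)%g) /\
  (range q = [set: nat] \/ exists n, range q = `I_n).

Lemma coset_numbering_exists : exists q, coset_numbering q.
Proof.
have /countable_injP[f finj] := countable_G.
(* One representative for each coset: elements of the same coset hand the same set to [xget]. The
   default is never taken, since [g] lies in its own coset. *)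
pose rep g := xget 1%g [set h | H (g^-1 * h)%g].
have repE g h : rep g = rep h <-> H (g^-1 * h)%g.
  have Hrep k : H (k^-1 * rep k)%g.
    by rewrite /rep; case: xgetP => [//|/(_ k)]; rewrite /= mulVg.
  split=> [e|Hgh].
    have -> : (g^-1 * h = g^-1 * rep g * (h^-1 * rep h)^-1)%g.
      by rewrite invgM invgK e mulgA mulgK.
    by apply: HM => //; exact: HV.
  congr (xget _ _); apply/seteqP; split=> k /= Hk.
    have -> : (h^-1 * k = (g^-1 * h)^-1 * (g^-1 * k))%g by rewrite invgM invgK mulgA mulgK.
    by apply: HM => //; exact: HV.
  have -> : (g^-1 * k = g^-1 * h * (h^-1 * k))%g by rewrite mulgA mulgK.
  exact: HM.
pose q0 g := f (rep g).
have q0E g h : q0 g = q0 h <-> H (g^-1 * h)%g.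
  rewrite -repE /q0; split=> [/finj|->//]; apply; exact: in_setT.
have renumber (J : set nat) : (range q0 #= J)%card -> exists q : G -> nat,
    (forall g h, q g = q h <-> H (g^-1 * h)%g) /\ range q = J.
  move=> /card_set_bijP[u ubij]; exists (u \o q0); split=> [g h|].
    rewrite -q0E; split=> [|/= ->//].
    by apply: (set_bij_inj ubij); rewrite inE; [exists g|exists h].
  apply/seteqP; split=> [_ [g _ <-]|j /(set_bij_surj ubij)[_ [g _ <-] <-]].
    by apply: (set_bij_homo ubij); exists g.
  by exists g.
have [/finite_setP[n /renumber[q [qE qn]]]|infq] := pselect (finite_set (range q0)).
  by exists q; split=> //; right; exists n.
have [|q [qE qT]] := renumber [set: nat].
  by rewrite eq_card_nat//; exact: countableP.
by exists q; split=> //; left.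
Qed.

Context (q : G -> nat).
Hypothesis qE : forall g h, q g = q h <-> H (g^-1 * h)%g.

(** Left translation of cosets, carried over to their numbers; other naturals stay fixed. *)
Definition coset_action (g : G) (n : nat) : nat :=
  match pselect (exists h, q h = n) with
  | left e => q (g * projT1 (cid e))%g
  | right _ => n
  end.

Lemma coset_actionE g h : coset_action g (q h) = q (g * h)%g.
Proof.
rewrite /coset_action; case: pselect => [e|]; last by case; exists h.
by case: cid => k /= /qE qk; apply/qE; rewrite invgM -mulgA (mulgA g^-1%g) mulVg mul1g.
Qed.

Lemma coset_action_is_action : is_action coset_action.
Proof.
have out n g : ~ (exists h, q h = n) -> coset_action g n = n.
  by rewrite /coset_action; case: pselect.
split=> [n|g h n]; have [[k <-]|nq] := pselect (exists h, q h = n).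
- by rewrite coset_actionE mul1g.
- exact: out.
- by rewrite !coset_actionE mulgA.
- by rewrite !(out _ _ nq).
Qed.

Lemma coset_action_transitive i j : range q i -> range q j ->
  exists g, coset_action g i = j.
Proof.
by move=> [g _ <-] [h _ <-]; exists (h * g^-1)%g; rewrite coset_actionE mulgVK.
Qed.

Variable R : realType.

(** [q 1%g] is the number of the coset [H], which the elements of [H] fix. *)
Definition base_coset_set : set (coin_space R) := [set y | y (q 1%g)].

Lemma base_coset_set_image g :
  coordinate_action coset_action g @` base_coset_set =
  [set y : coin_space R | y (q g)].
Proof.
rewrite (act_image (coordinate_action_borel R coset_action_is_action).1).
apply/seteqP; split=> y; rewrite /preimage/= /coordinate_action/= invgK.
  by rewrite /base_coset_set/= coset_actionE mulg1.
by rewrite /base_coset_set/= coset_actionE mulg1.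
Qed.

Lemma base_coset_set_stable h : H h ->
  coordinate_action coset_action h @` base_coset_set = base_coset_set.
Proof.
move=> Hh; rewrite base_coset_set_image /base_coset_set.
by have -> : q h = q 1%g by apply/qE; rewrite mulg1; exact: HV.
Qed.

End Cosets.

(** * Finite index: uniform measure on the singletons *)

Section FiniteIndex.
Context (R : realType) (n : nat).
Local Notation Y := (coin_space R).
Local Open Scope ereal_scope.

Definition indicator_point (i : nat) : Y := fun j => j == i.

Definition indicator_sum : {measure set Y -> \bar R} :=
  msum (fun i => dirac (indicator_point i)) n.

(** The point mass is the default of [mnormalize], reached only for [n = 0]. *)
Definition indicator_prob : probability Y R :=
  mnormalize indicator_sum (dirac (indicator_point 0%N)).

Lemma indicator_sumE (A : set Y) :
  indicator_sum A = \sum_(i < n) (indicator_point i \in A)%:R%:E.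
Proof. by []. Qed.

Lemma indicator_sum_setT : indicator_sum setT = n%:R%:E.
Proof.
rewrite indicator_sumE (eq_bigr (fun=> 1%:E)) => [|i _]; last by rewrite in_setT.
by rewrite sumEFin big_const_ord iter_addr_0.
Qed.

Hypothesis n0 : (0 < n)%N.

Lemma indicator_probE (A : set Y) :
  indicator_prob A = indicator_sum A * (n%:R^-1)%:E.
Proof.
rewrite /indicator_prob/= /mnormalize.
have -> : indicator_sum [set: _] = n%:R%:E := indicator_sum_setT.
by rewrite eqe pnatr_eq0 -leqn0 leqNgt n0.
Qed.

Lemma indicator_prob_eq0 (A : set Y) :
  indicator_prob A = 0 <-> forall i, (i < n)%N -> ~ A (indicator_point i).
Proof.
rewrite indicator_probE; split=> [/eqP|nA].
  rewrite mule_eq0 => /orP[/eqP s0 i ni Ai|]; last first.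
    by rewrite eqe invr_eq0 pnatr_eq0 -leqn0 leqNgt n0.
  have : (\sum_(j < n) (indicator_point j \in A)%:R)%R == 0%R :> R.
    by rewrite -eqe -sumEFin -indicator_sumE s0.
  rewrite psumr_eq0//.
  move=> /allP/(_ (Ordinal ni) (mem_index_enum _))/=.
  by rewrite mem_set// oner_eq0.
rewrite indicator_sumE big1 ?mul0e// => i _.
by rewrite memNset//; exact: nA.
Qed.

Context (G : groupType) (p : G -> nat -> nat).
Hypothesis act_p : is_action p.
Hypothesis stable_p : forall g i, (i < n)%N -> (p g i < n)%N.
Hypothesis trans_p : forall i j, (i < n)%N -> (j < n)%N -> exists g, p g i = j.

Lemma coordinate_action_indicator g i :
  coordinate_action p g (indicator_point i) = indicator_point (p g i).
Proof.
apply/funext => j; rewrite /coordinate_action /indicator_point/=.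
by apply/eqP/eqP => [<-|->]; rewrite -act_p.2 (mulgV, mulVg) act_p.1.
Qed.

Lemma indicator_prob_pmp : pmp (coordinate_action p) indicator_prob.
Proof.
move=> A g mA; rewrite !indicator_probE; congr (_ * _); rewrite !indicator_sumE.
(* The permutation of the [n] points induced by [g], along which the sum is reindexed. *)
pose u (i : 'I_n) : 'I_n := Ordinal (stable_p g (ltn_ord i)).
have iu : injective u by move=> i j [/(can_inj (actK act_p g))/val_inj].
rewrite (reindex_inj iu)/=; apply: eq_bigr => i _; congr (_%:R%:E).
rewrite -coordinate_action_indicator; congr nat_of_bool; apply/idP/idP.
  rewrite !inE => -[y Ay] /(can_inj (actK (coordinate_action_borel R act_p).1 g)).
  by move=> <-.
by rewrite !inE => Ai; exists (indicator_point i).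
Qed.

(** By transitivity an invariant set contains all of the [n] points or none. *)
Lemma indicator_prob_ergodic : ergodic (coordinate_action p) indicator_prob.
Proof.
move=> A [B /= mB [M [N [mN N0 MN]] <-]] iA.
have [[i [ni Ai]]|nA] := pselect (exists i, (i < n)%N /\ (B `|` M) (indicator_point i)).
  right; exists (~` B); split; first exact: measurableC.
    apply/indicator_prob_eq0 => j nj; apply; have [g gij] := trans_p ni nj.
    have : (B `|` M) (indicator_point j).
      by rewrite -(iA g) -gij -coordinate_action_indicator; exists (indicator_point i).
    by move=> [//|/MN Nj]; move/indicator_prob_eq0: N0 => /(_ _ nj).
  by move=> y /= h By; apply: h; left.
left; apply: negligibleU; last by exists N; split.
exists B; split=> //; apply/indicator_prob_eq0 => i ni Bi.
by apply: nA; exists i; split=> //; left.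
Qed.

End FiniteIndex.

(** * An ergodic action in which a proper subgroup is not ergodic *)

Section SubgroupAction.
Context (R : realType) (G : groupType) (H : set G).
Hypothesis countable_G : countable [set: G].
Hypotheses (H1 : H 1%g) (HM : forall g h, H g -> H h -> H (g * h)%g).
Hypothesis HV : forall g, H g -> H g^-1%g.
Local Notation Y := (coin_space R).

(** The last clause is restricted to proper [H]: for [H] the whole group, ergodicity makes the
    non-null set [D] conull. *)
Definition separating_action (b : G -> Y -> Y) (nu : probability Y R) (D : set Y) :=
  [/\ borel_action b, pmp b nu & ergodic b nu] /\
  [/\ measurable D, forall h, H h -> b h @` D = D, nu D <> 0%E &
      (exists g, ~ H g) -> nu (~` D) <> 0%E].

(** The flip at [n] exchanges the two sets, whose masses add up to one. *)
Lemma coin_coordinate_neq0 n :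
  coin R [set y | y n] <> 0%E /\ coin R [set y | ~~ y n] <> 0%E.
Proof.
have mD := @coordinate_measurable R n.
have DC : ~` [set y : Y | y n] = [set y : Y | ~~ y n].
  by apply/seteqP; split=> y /= /negP.
have flipD : coin R [set y | ~~ y n] = coin R [set y | y n].
  rewrite -(@coin_flip R n _ mD); congr (coin R _).
  by apply/seteqP; split=> y; rewrite /preimage/= /flip eqxx.
suff D0 : coin R [set y | y n] <> 0%E by rewrite flipD.
move=> D0; have := probability_setC (coin R) mD.
by rewrite DC flipD D0 sube0 => /esym/eqP; rewrite onee_eq0.
Qed.

Lemma separating_action_exists : exists b nu D, separating_action b nu D.
Proof.
have [q [qE qrange]] := coset_numbering_exists countable_G H1 HM HV.
have act_p := coset_action_is_action qE; set p := coset_action q in act_p.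
pose D := @base_coset_set G q R.
have mD : measurable D by exact: coordinate_measurable.
have stD h : H h -> coordinate_action p h @` D = D by exact: base_coset_set_stable.
have borel_p := coordinate_action_borel R act_p.
case: qrange => [qT|[n qn]].
  exists (coordinate_action p), (coin R), D; split; split=> //.
  - exact: coordinate_action_pmp.
  - apply: coin_ergodic => // i j.
    by apply: (coset_action_transitive qE); rewrite qT.
  - by case: (coin_coordinate_neq0 (q 1%g)).
  - move=> _; have := (coin_coordinate_neq0 (q 1%g)).2.
    suff -> : [set y : Y | ~~ y (q 1%g)] = ~` D by [].
    by apply/seteqP; split=> y /= /negP.
have qlt g : (q g < n)%N.
  by have : range q (q g) by [exists g]; rewrite qn.
have n0 : (0 < n)%N by exact: leq_ltn_trans (qlt 1%g).
have in_q i : (i < n)%N -> range q i by rewrite qn.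
exists (coordinate_action p), (indicator_prob R n), D; split; split=> //.
- apply: indicator_prob_pmp => // g i /in_q[h _ <-].
  by rewrite /p (coset_actionE qE).
- apply: indicator_prob_ergodic => // i j /in_q qi /in_q qj.
  exact: (coset_action_transitive qE).
- move/(indicator_prob_eq0 n0)/(_ _ (qlt 1%g)); apply.
  by rewrite /D /base_coset_set/= /indicator_point eqxx.
(* The point of the coset of [g] lies outside [D], as [g] is not in [H]. *)
- move=> [g Hg] /(indicator_prob_eq0 n0)/(_ _ (qlt g)); apply => /=.
  rewrite /D /base_coset_set/= /indicator_point => /eqP/qE.
  by rewrite invg1 mul1g.
Qed.

End SubgroupAction.

(** * Weak mixing implies chaining *)

Section WeakMixing.
Context (R : realType) (G : groupType) d (X : measurableType d).
Context (mu : probability X R) (a : G -> X -> X).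
Hypotheses (countable_G : countable [set: G]).
Hypotheses (borel_a : borel_action a) (mcp_a : mcp a mu).

Section Reach.
Variable A : set X.

(** The subgroup generated by the [s] in [reachM]. Generators are multiplied on the right, so that
    each one appends a translate to a chain; they are closed under inversion. *)
Inductive reach : G -> Prop :=
| reach1 : reach 1%g
| reachM g s : reach g -> ~ mu.-negligible (a s @` A `&` A) -> reach (g * s)%g.

Lemma reach_gen s : ~ mu.-negligible (a s @` A `&` A) -> reach s.
Proof. by move=> sA; rewrite -[s]mul1g; apply: reachM => //; exact: reach1. Qed.

Lemma reach_mul g h : reach g -> reach h -> reach (g * h)%g.
Proof.
by move=> rg; elim=> [|h' s _ IH sA]; rewrite ?mulg1// mulgA; exact: reachM.
Qed.

Lemma reach_inv g : reach g -> reach g^-1%g.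
Proof.
elim=> [|h s _ IH sA]; first by rewrite invg1; exact: reach1.
rewrite invgM; apply: reach_mul => //; apply: reach_gen => sV; apply: sA.
apply/(act_negligible borel_a mcp_a s^-1%g).
rewrite (act_imageI borel_a.1) -(act_imageM borel_a.1) mulVg.
by rewrite (act_image1 borel_a.1) setIC.
Qed.

(** The partial products form the chain: moving the overlap of [A] with its translate by [s] along
    [h] gives the overlap of the translates by [h] and [h * s]. *)
Lemma reach_chain g : reach g -> exists k c, [/\ c 0%N = 1%g, c k = g &
  forall i, (i < k)%N -> ~ mu.-negligible (a (c i) @` A `&` a (c i.+1) @` A)].
Proof.
elim=> [|h s _ [k [c [c0 ck cS]]] sA]; first by exists 0%N, (fun=> 1%g).
exists k.+1, (fun i => if (i <= k)%N then c i else (h * s)%g); split=> //.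
  by rewrite ltnn.
move=> i; rewrite ltnS => ik; have [->|{}ik] : i = k \/ (i < k)%N by lia.
  rewrite leqnn ltnn ck (act_imageM borel_a.1) -(act_imageI borel_a.1) setIC.
  by move/(act_negligible borel_a mcp_a).
by rewrite /= ik (ltnW ik); exact: cS.
Qed.

Lemma reach_chains_to g B : reach g -> ~ mu.-negligible (a g @` A `&` B) ->
  exists l, chains_to a mu l A B.
Proof.
move=> /reach_chain[k [c [c0 ck cS]]] gAB; exists k, c; split=> //.
  by move=> i ik; apply/mu_ext_gt0; exact: cS.
by rewrite ck; exact/mu_ext_gt0.
Qed.

(** Used for a Borel subset [A0] of [A], to get a Borel union, while [reach] still refers to [A]. *)
Definition saturation (A0 : set X) : set X := \bigcup_(h in reach) (a h @` A0).

Lemma saturation_stable (A0 : set X) h : reach h ->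
  a h @` saturation A0 = saturation A0.
Proof.
have sub k : reach k -> a k @` saturation A0 `<=` saturation A0.
  move=> rk _ [_ [g rg [x Ax <-]] <-]; exists (k * g)%g; first exact: reach_mul.
  by exists x => //; rewrite borel_a.1.2.
move=> rh; apply/seteqP; split; first exact: sub.
move=> x Cx; exists (a h^-1%g x); last by rewrite (actVK borel_a.1).
by apply: (sub _ (reach_inv rh)); exists x.
Qed.

Lemma countable_reach : countable reach.
Proof. by apply: sub_countable countable_G; exact: subset_card_le. Qed.

Lemma saturation_measurable (A0 : set X) : measurable A0 ->
  measurable (saturation A0).
Proof.
move=> mA0; rewrite /saturation bigcup_mkcond.
apply: countable_bigcupT_measurable => // h; case: ifP => // _.
exact: act_measurable.
Qed.

Lemma saturation_disjoint (A0 : set X) g : A0 `<=` A -> ~ reach g ->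
  mu.-negligible (a g @` saturation A0 `&` saturation A0).
Proof.
move=> A0A rg.
apply: (negligibleS (A := \bigcup_(h in reach) \bigcup_(k in reach)
    (a (g * h)%g @` A `&` a k @` A))).
  move=> _ [[_ [h rh [x Ax <-]] <-] [k rk [y Ay yx]]]; exists h => //; exists k => //.
  by split; [exists x; rewrite ?borel_a.1.2//; exact: A0A|exists y => //; exact: A0A].
apply: negligible_countable_bigcup countable_reach _ => h rh.
apply: negligible_countable_bigcup countable_reach _ => k rk.
apply: contrapT => ghk; apply: rg.
(* If the translates by [g * h] and [k] overlap, the middle factor is a generator. *)
have -> : g = (k * (k^-1 * (g * h)) * h^-1)%g by rewrite mulgA mulgV mul1g mulgK.
apply: reach_mul; last exact: reach_inv.
apply: reach_mul => //; apply: reach_gen => n; apply: ghk.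
apply/(act_negligible borel_a mcp_a k^-1%g).
rewrite (act_imageI borel_a.1) -!(act_imageM borel_a.1) mulVg.
by rewrite (act_image1 borel_a.1).
Qed.

End Reach.

(** * Ergodicity of products *)

Section Product.
Context d' (Y : measurableType d') (nu : probability Y R) (b : G -> Y -> Y).
Hypothesis borel_b : borel_action b.
Local Notation mn := (mu \x nu)%E.

Definition orbit_rectangle (C : set X) (D : set Y) : set (X * Y) :=
  \bigcup_(g in [set: G]) ((a g @` C) `*` (b g @` D)).

Lemma orbit_rectangle_measurable C D : measurable C -> measurable D ->
  measurable (orbit_rectangle C D).
Proof.
move=> mC mD; apply: countable_bigcupT_measurable => // g.
by apply: measurableX; [exact: act_measurable borel_a _ _ _|
  exact: act_measurable borel_b _ _ _].
Qed.

Lemma diag_is_action : is_action (diag_action a b).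
Proof.
split=> [[x y]|g h [x y]]; rewrite /diag_action/=.
  by rewrite borel_a.1.1 borel_b.1.1.
by rewrite borel_a.1.2 borel_b.1.2.
Qed.

Lemma orbit_rectangle_invariant C D g :
  diag_action a b g @` orbit_rectangle C D = orbit_rectangle C D.
Proof.
have sub k : diag_action a b k @` orbit_rectangle C D `<=` orbit_rectangle C D.
  move=> _ [[_ _] [h _ /= [[x Cx <-] [y Dy <-]]] <-]; exists (k * h)%g => //.
  by split=> /=; [exists x|exists y] => //; rewrite (borel_a.1.2, borel_b.1.2).
apply/seteqP; split; first exact: sub.
move=> z Ez; exists (diag_action a b g^-1%g z); last exact: (actVK diag_is_action).
by apply: (sub g^-1%g); exists z.
Qed.

Lemma rectangle_negligible C D : measurable C -> measurable D ->
  mn.-negligible (C `*` D) -> mu C = 0%E \/ nu D = 0%E.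
Proof.
move=> mC mD n; have mnE := @product_measure1E _ _ _ _ _ mu nu C D mC mD.
have /eqP := etrans (esym mnE) (measure_negligible (measurableX mC mD) n).
by rewrite mule_eq0 => /orP[]/eqP; [left|right].
Qed.

Lemma rectangle_orbit C D : C `*` D `<=` orbit_rectangle C D.
Proof.
move=> [x y] [Cx Dy]; exists 1%g => //.
by split; [exists x|exists y] => //; rewrite (borel_a.1.1, borel_b.1.1).
Qed.

Lemma negligible_cylinder (N : set X) : mu.-negligible N ->
  mn.-negligible (N `*` [set: Y]).
Proof.
move=> [M [mM M0 NM]]; exists (M `*` setT); split; first exact: measurableX.
  have mnE := @product_measure1E _ _ _ _ _ mu nu M setT mM measurableT.
  by rewrite -[RHS](mul0e (nu setT)) -M0; exact: mnE.
by move=> [x y] [/NM].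
Qed.

(* On the overlap of the two orbits, [a g @` C] meets [a k @` C] and [b g @` D]
   meets [b k @` ~` D]; the latter forces [g^-1 * k] outside of [H]. *)
Lemma orbit_rectangle_disjoint (H : set G) C D :
  (forall h, H h -> b h @` D = D) ->
  (forall g, ~ H g -> mu.-negligible (a g @` C `&` C)) ->
  mn.-negligible (orbit_rectangle C D `&` orbit_rectangle C (~` D)).
Proof.
move=> stD disjC;
apply: (negligibleS (A := \bigcup_(g in [set: G]) \bigcup_(k in [set: G])
    ((if `[< H (k^-1 * g)%g >] then set0 else a g @` C `&` a k @` C) `*` [set: Y]))).
  move=> [x y] [[g _ [gx gy]] [k _ [kx ky]]]; exists g => //; exists k => //.
  split=> //; rewrite [(x, y).1]/=; case: asboolP => // /stD HD.
  move: ky; rewrite (act_imageC borel_b.1) => kD; apply: kD.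
  by rewrite -HD -(act_imageM borel_b.1) mulgA mulgV mul1g.
apply: negligible_countable_bigcup => // g _.
apply: negligible_countable_bigcup => // k _; apply: negligible_cylinder.
case: asboolP => [_|/disjC n]; first exact: negligible_set0.
apply/(act_negligible borel_a mcp_a k^-1%g).
rewrite (act_imageI borel_a.1) -!(act_imageM borel_a.1) mulVg.
by rewrite (act_image1 borel_a.1).
Qed.

Hypothesis erg : ergodic (diag_action a b) mn.

(** The orbit of [C] times [D] is invariant and not null, hence conull. The orbit of [C] times the
    complement of [D] almost misses it, so it is null, while [C] is not. *)
Lemma ergodic_diag_stabilizer (H : set G) C D : measurable C -> measurable D ->
  (forall h, H h -> b h @` D = D) ->
  (forall g, ~ H g -> mu.-negligible (a g @` C `&` C)) ->
  mu C <> 0%E -> nu D <> 0%E -> nu (~` D) = 0%E.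
Proof.
move=> mC mD stD disjC C0 D0; have mDC := measurableC mD.
have E0 : ~ mn.-negligible (orbit_rectangle C D).
  by move/(negligibleS (@rectangle_orbit C D))/(rectangle_negligible mC mD)=> [].
have [//|cE] := erg (measurable_mu_measurable _ (orbit_rectangle_measurable mC mD))
  (orbit_rectangle_invariant C D).
suff : mn.-negligible (orbit_rectangle C (~` D)).
  by move/(negligibleS (@rectangle_orbit C _))/(rectangle_negligible mC mDC)=> [].
apply: negligibleS (negligibleU (orbit_rectangle_disjoint stD disjC) cE).
move=> z Ez; have [|] := pselect (orbit_rectangle C D z); first by left.
by right.
Qed.

(** Ergodicity of the product passes to the first factor through the cylinder over [C]. *)
Lemma ergodic_diag_fst C : measurable C -> (forall g, a g @` C = C) ->
  mu C <> 0%E -> mu.-negligible (~` C).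
Proof.
move=> mC iC C0; have mCT : measurable (C `*` [set: Y]) by exact: measurableX.
have iE g : diag_action a b g @` (C `*` [set: Y]) = C `*` [set: Y].
  rewrite (act_image diag_is_action); apply/seteqP; split=> -[x y] [/= Cx _]; split=> //=.
    by move: Cx; rewrite -{1}(iC g^-1%g) => -[z Cz /(can_inj (actK borel_a.1 _))<-].
  by rewrite -(iC g^-1%g); exists x.
have [/(rectangle_negligible mC measurableT)[//|/eqP]|cE] :=
  erg (measurable_mu_measurable _ mCT) iE.
  by rewrite probability_setT onee_eq0.
have [C0'|/eqP] : mu (~` C) = 0%E \/ nu [set: Y] = 0%E.
- apply: rectangle_negligible => //; first exact: measurableC.
  by apply: negligibleS cE => -[x y] [/= Cx _] [].
- by exists (~` C); split=> //; exact: measurableC.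
- by rewrite probability_setT onee_eq0.
Qed.

End Product.

Lemma weakly_mixing_chaining : weakly_mixing a mu -> chaining a mu.
Proof.
move=> wm A B [mA /mu_ext_gt0 An] [mB /mu_ext_gt0 Bn].
apply: contrapT => nchain.
have [A0 [mA0 A0A A0n]] := mu_measurable_core mA.
have A0nn : ~ mu.-negligible A0.
  move=> n; apply: An; apply: negligibleS (negligibleU n A0n) => x Ax.
  by have [|] := pselect (A0 x); [left|right].
pose C := saturation A A0.
have mC : measurable C by exact: saturation_measurable.
have A0C : A0 `<=` C.
  by move=> x Ax; exists 1%g; [exact: reach1|rewrite (act_image1 borel_a.1)].
have C0 : mu C <> 0%E by move=> C0; apply: A0nn; exists C.
have CB : mu.-negligible (C `&` B).
  apply: (negligibleS (A := \bigcup_(h in reach A) (a h @` A `&` B))).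
    move=> x [[h rh [y Ay <-]] Bx]; exists h => //; split=> //.
    by exists y => //; exact: A0A.
  apply: negligible_countable_bigcup (countable_reach A) _ => h rh.
  by apply: contrapT => /(reach_chains_to rh).
have [b [nu [D [[borel_b pmp_b erg_b] [mD stD D0 DC0]]]]] :=
  separating_action_exists R countable_G (reach1 A) (@reach_mul A) (@reach_inv A).
have erg := wm _ _ nu b (coin_space_standard R) borel_b pmp_b erg_b.
(* If every element is reached, [C] is invariant, hence conull, and [B] would be null. Otherwise [D]
   contradicts ergodicity of the product. *)
have [all_reach|/existsNP not_all] := pselect (forall g, reach A g).
  apply: Bn; have Cc : mu.-negligible (~` C).
    apply: (ergodic_diag_fst borel_b erg mC _ C0) => g.
    exact: saturation_stable.
  apply: negligibleS (negligibleU CB Cc) => x Bx.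
  by have [|] := pselect (C x); [left|right].
apply: (DC0 not_all).
exact: (ergodic_diag_stabilizer borel_b erg mC mD stD
  (fun g => @saturation_disjoint A A0 g A0A) C0 D0).
Qed.

End WeakMixing.

Theorem theorem1p1 (R : realType) (G : groupType) (d : measure_display)
    (X : measurableType d) (mu : probability X R) (a : G -> X -> X)
    (countable_G : countable [set: G])
    (standard_X : standard_borel R X)
    (borel_a : borel_action a)
    (mcp_a : mcp a mu) :
  [/\ essentially_boundedly_chaining a mu -> metrically_ergodic a mu,
      weakly_mixing a mu -> chaining a mu &
      chaining a mu -> ergodic a mu].
Proof.
split.
- exact: essentially_boundedly_chaining_metrically_ergodic.
- exact: weakly_mixing_chaining.
- exact: chaining_ergodic.
Qed.
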